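(* Let $\lambda$ be a nonzero real parameter, $m\in\mathbb{N}$ and $n,k,r\in\mathbb{N}\cup\{0\}$. Then \[ \frac{1}{k!\,m^k}\sum_{j=0}^{n}\lambda^{n-j}S_1(n,j)\,m^j\,\Delta^k\left(\frac{r}{m}\right)^j=\begin{cases} W_{m,r}(n,k\mid\lambda), & \text{if } n\ge k,\\ 0, & \text{if } n<k.\end{cases} \]
   Context: $S_1(n,j)$ denotes the (signed) Stirling numbers of the first kind: $x(x-1)\cdots(x-n+1)=\sum_{j=0}^n S_1(n,j)x^j$. $\Delta$ is the forward difference operator $\Delta f(x)=f(x+1)-f(x)$; the notation $\Delta^k\left(\frac{r}{m}\right)^j$ means $\Delta^k$ applied to $x\mapsto x^j$ evaluated at $x=r/m$, i.e. $\sum_{l=0}^k\binom{k}{l}(-1)^{k-l}\left(l+\frac{r}{m}\right)^j$. The degenerate Whitney numbers $W_{m,r}(n,k\mid\lambda)$ are defined by \[ \frac{1}{m^k k!}(1+\lambda t)^{r/\lambda}\big((1+\lambda t)^{m/\lambda}-1\big)^k=\sum_{n=k}^\infty W_{m,r}(n,k\mid\lambda)\frac{t^n}{n!}. \] *)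

(* Defs.v *)
From mathcomp Require Import all_boot all_order all_algebra.
From mathcomp Require Import all_classical all_reals all_analysis.

Set Implicit Arguments.
Unset Strict Implicit.
Unset Printing Implicit Defensive.

Import Order.TTheory GRing.Theory Num.Theory numFieldNormedType.Exports.
Local Open Scope classical_set_scope.
Local Open Scope ring_scope.

(** Signed Stirling numbers of the first kind: the coefficients of the
    falling factorial [x (x - 1) ... (x - n + 1)]. *)
Definition stirling1 (n j : nat) : int :=
  (\prod_(i < n) ('X - (i%:R)%:P) : {poly int})`_j.

Definition fwd_diff (R : realType) (f : R -> R) : R -> R :=
  fun x => f (x + 1) - f x.

(** The real powers are only meaningful for [0 < 1 + lam * t]; this holds for
    [t] close to [0], which is the only range used below. *)
Definition whitney_egf (R : realType) (lam : R) (m r k : nat) (t : R) : R :=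
  (m%:R ^+ k * k`!%:R)^-1 * (1 + lam * t) `^ (r%:R / lam)
  * ((1 + lam * t) `^ (m%:R / lam) - 1) ^+ k.

Definition whitney_expansion (R : realType) (lam : R) (m r k : nat)
    (w : nat -> R) : Prop :=
  \forall t \near (0 : R),
    (fun N => \sum_(k <= n < N) w n * (t ^+ n / n`!%:R)) @ \oo
      --> whitney_egf lam m r k t.

(** [W_{m,r}(n, k | lam)]: the coefficients of the expansion, obtained by
    classical choice. The expansion starts at [n = k], hence it determines
    these values only for [k <= n]; the values for [n < k] are junk. *)
Definition degenerate_whitney (R : realType) (lam : R) (m r n k : nat) : R :=
  get [set w : nat -> R | whitney_expansion lam m r k w] n.

(* Main.v *)
(** By the binomial series, the generalized falling factorials
    [x (x - lam) ... (x - (n - 1) lam)] are the exponential coefficients of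
    [(1 + lam t)^(x / lam)]; the coefficients of the former in [x] are
    [lam^(n - j) S_1(n, j)]. Expanding the [k]-th power in the generating
    function of the Whitney numbers by the binomial theorem gives an
    alternating sum of such series at [x = r + m l], which is the [k]-th forward
    difference at [r / m]. The coefficients with [n < k] vanish because [k]
    differences kill powers below [k], so the expansion does start at [n = k],
    and uniqueness of power series coefficients concludes. *)
Require Import Defs.
From mathcomp Require Import all_boot all_order all_algebra.
From mathcomp Require Import all_classical all_reals all_analysis.
From mathcomp Require Import ring lra.
Import Order.TTheory GRing.Theory Num.Theory numFieldNormedType.Exports.
Local Open Scope ring_scope.

(** * Power series near 0: convergence, differentiation, uniqueness of coefficients *)

Section PowerSeries.
Context {R : realType}.
Implicit Types (c : nat -> R) (f : R -> R).

(* Equivalent to convergence of [pseries c] near [0], but visibly stable under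
   [pseries_diffs]; this replaces any use of the radius of convergence. *)
Definition geom_bounded c :=
  exists2 B : R, 0 < B & exists C, forall n, `|c n| <= C * B ^+ n.

Lemma near0P (P : R -> Prop) : (\forall t \near (0 : R), P t) <->
  exists2 e : R, 0 < e & forall t, `|t| < e -> P t.
Proof.
split=> [/nbhs_ballP[e /= e0 eP]|[e e0 eP]].
  by exists e => // t te; apply: eP; rewrite /ball /= sub0r normrN.
by apply/nbhs_ballP; exists e => // t; rewrite /ball /= sub0r normrN; exact: eP.
Qed.

(** The factor [n.+1] brought down by differentiation is at most [2 ^+ n], so doubling [B] absorbs
    it. *)
Lemma geom_bounded_diffs c : geom_bounded c -> geom_bounded (pseries_diffs c).
Proof.
move=> [B B0 [C cC]]; exists (2 * B); first by rewrite mulr_gt0.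
exists (C * B) => n; rewrite /pseries_diffs normrM normr_nat.
have C0 : 0 <= C by have := cC 0%N; rewrite expr0 mulr1; exact: le_trans.
apply: (@le_trans _ _ (2 ^+ n * (C * B ^+ n.+1))); last first.
  by rewrite exprMn exprS le_eqVlt; apply/orP; left; apply/eqP; ring.
by apply: ler_pM => //; rewrite -natrX ler_nat ltn_expl.
Qed.

(** Comparison with the geometric series of ratio [B * |t|], which is below 1 once [|t| < B^-1]. *)
Lemma geom_bounded_near_cvg c : geom_bounded c ->
  \forall t \near (0 : R), cvgn (pseries c t).
Proof.
move=> [B B0 [C cC]].
have C0 : 0 <= C by have := cC 0%N; rewrite expr0 mulr1; exact: le_trans.
apply/near0P; exists B^-1; first by rewrite invr_gt0.
move=> t tB.
apply: normed_cvg; apply: (@series_le_cvg _ _ (geometric C (B * `|t|))) => [n|n|n|].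
- exact: normr_ge0.
- by apply: mulr_ge0 => //; apply: exprn_ge0; apply: mulr_ge0 => //; exact: ltW.
- by rewrite /= normrM normrX exprMn mulrA ler_wpM2r// exprn_ge0.
- apply: is_cvg_geometric_series; rewrite normrM normr_id gtr0_norm//.
  by rewrite -lter_pdivlMl// mulr1.
Qed.

(** Convergence at the single point [e / 2] bounds the terms there; dividing by [(e / 2) ^+ n]
    bounds the coefficients. *)
Lemma cvg_geom_bounded c : (\forall t \near (0 : R), cvgn (pseries c t)) ->
  geom_bounded c.
Proof.
move=> /near0P[e e0 ce].
have h0 : 0 < e / 2 by rewrite divr_gt0.
have : cvgn (pseries c (e / 2)).
  by apply: ce; rewrite gtr0_norm// ltr_pdivrMr// ltr_pMr// ltr1n.
move=> /cvg_series_bounded[K [Kreal cK]].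
exists (e / 2)^-1; first by rewrite invr_gt0.
exists (K + 1) => n; rewrite exprVn ler_pdivlMr ?exprn_gt0//.
rewrite -[X in _ * X]gtr0_norm ?exprn_gt0// -normrM.
by apply: cK => //; rewrite ltrDl.
Qed.

(** Termwise differentiation at [t] needs the series and its first two derived series to converge at
    a point of larger norm; geometric boundedness passes to both derived series. *)
Lemma geom_bounded_near_derive c : geom_bounded c ->
  \forall t \near (0 : R), is_derive t (1 : R)
    (fun t => limn (pseries c t)) (limn (pseries (pseries_diffs c) t)).
Proof.
move=> bc; have bdc := geom_bounded_diffs c bc.
have /near0P[e e0 He] : \forall t \near (0 : R), [/\ cvgn (pseries c t),
      cvgn (pseries (pseries_diffs c) t) &
      cvgn (pseries (pseries_diffs (pseries_diffs c)) t)].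
  near=> t; split; near: t; apply: geom_bounded_near_cvg => //.
  exact: geom_bounded_diffs.
have h0 : 0 < e / 2 by rewrite divr_gt0.
have he : e / 2 < e by rewrite ltr_pdivrMr// ltr_pMr// ltr1n.
have [] := He (e / 2); first by rewrite gtr0_norm.
move=> C0 C1 C2; apply/near0P; exists (e / 2) => // t te.
by apply: (pseries_snd_diffs C0 C1 C2); rewrite (gtr0_norm h0).
Unshelve. all: by end_near.
Qed.

Lemma pseries_at0 c : limn (pseries c 0) = c 0%N.
Proof.
apply: lim_near_cst => //; near=> n.
rewrite /pseries /series /= -[n]prednK; last by near: n; exact: nbhs_infty_gt.
rewrite big_nat_recl//= expr0 mulr1 big1 ?addr0// => i _.
by rewrite expr0n mulr0.
Unshelve. all: by end_near.
Qed.

(** Induction on [n] for all [c] at once: the constant term is the value at 0, and the derived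
    series also sums to 0 near 0, with [n]-th coefficient [n.+1%:R * c n.+1]. *)
Lemma pseries_eq0 c : (\forall t \near (0 : R), cvgn (pseries c t)) ->
  (\forall t \near (0 : R), limn (pseries c t) = 0) -> forall n, c n = 0.
Proof.
move=> /cvg_geom_bounded bc c0 n; elim: n c bc c0 => [|n IHn] c bc c0.
  by rewrite -pseries_at0; exact: nbhs_singleton c0.
have : pseries_diffs c n = 0.
  apply: IHn; first exact: geom_bounded_diffs.
  near=> t.
  have cd : is_derive t (1 : R) (fun t => limn (pseries c t))
      (limn (pseries (pseries_diffs c) t)).
    by near: t; exact: geom_bounded_near_derive.
  have ct0 : is_derive t (1 : R) (fun t => limn (pseries c t)) 0.
    apply: (@near_eq_is_derive _ _ _ (cst 0)).
    (* A derivative at [t] needs the sum to vanish around [t], not only at [t]; [near_join] provides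
       this for all [t] near 0. *)
    by near: t; apply: filterS (near_join c0) => u; apply: filterS => v ->.
  by case: cd => _ <-; case: ct0.
by move/eqP; rewrite /pseries_diffs mulf_eq0 pnatr_eq0/= => /eqP.
Unshelve. all: by end_near.
Qed.

Lemma near_derive0_cst f : (\forall t \near (0 : R), is_derive t (1 : R) f 0) ->
  \forall t \near (0 : R), f t = f 0.
Proof.
move=> /near0P[e e0 fe]; apply/near0P; exists e => // t te.
have fd u : `|u| <= `|t| -> is_derive u (1 : R) f 0.
  by move=> ut; apply: fe; exact: le_lt_trans te.
have cst (a b : R) : a <= b -> `|a| <= `|t| -> `|b| <= `|t| -> f b = f a.
  move=> ab at' bt.
  have dab u : u \in `[a, b] -> is_derive u (1 : R) f 0.
    rewrite in_itv/= => /andP[au ub]; apply: fd.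
    rewrite ler_norml; move: at' bt; rewrite !ler_norml => /andP[a1 _] /andP[_ b2].
    by rewrite (le_trans a1 au) (le_trans ub b2).
  have dab' u : u \in `]a, b[ -> is_derive u (1 : R) f ((fun=> 0) u).
    by move=> /subset_itv_oo_cc; exact: dab.
  have fc : {within `[a, b], continuous f}%classic.
    by apply: derivable_within_continuous => u /dab[].
  have [c _] := MVT_segment ab dab' fc.
  by rewrite mul0r => /eqP; rewrite subr_eq0 => /eqP.
have [t0|t0] := leP 0 t; first by apply: cst; rewrite ?normr0.
by symmetry; apply: cst; rewrite ?normr0// ltW.
Qed.

End PowerSeries.

(** * The binomial series with step [lam] *)

Section BinomialSeries.
Local Open Scope classical_set_scope.
Local Open Scope ring_scope.
Context {R : realType}.
Implicit Types lam x t : R.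

Definition step_falling lam x n : R := \prod_(i < n) (x - i%:R * lam).

(** For [lam != 0] this is [lam ^+ n] times the generalized binomial coefficient of [x / lam] over
    [n]. *)
Definition step_bin lam x n := step_falling lam x n / n`!%:R.

Lemma step_binS lam x n : n.+1%:R * step_bin lam x n.+1 = (x - n%:R * lam) * step_bin lam x n.
Proof.
rewrite /step_bin /step_falling big_ord_recr/= factS natrM.
have n0 : n.+1%:R != 0 :> R by rewrite pnatr_eq0.
have f0 : n`!%:R != 0 :> R by rewrite pnatr_eq0 -lt0n fact_gt0.
by field; rewrite f0 nat1r n0.
Qed.

(** By [step_binS], passing from [n] to [n.+1] multiplies by [(x - n%:R * lam) / n.+1%:R], of norm
    at most [|x| + |lam|]; the extra 1 keeps [B] positive. *)
Lemma step_bin_geom_bounded lam x : geom_bounded (step_bin lam x).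
Proof.
have B0 : 0 < `|x| + `|lam| + 1 :> R by rewrite ltr_wpDl// addr_ge0.
exists (`|x| + `|lam| + 1) => //; exists 1 => n; rewrite mul1r.
elim: n => [|n IHn].
  by rewrite /step_bin /step_falling big_ord0 fact0 divr1 normr1.
have n0 : 0 < n.+1%:R :> R by rewrite ltr0n.
rewrite -(ler_pM2l n0) -{1}(normr_nat _ n.+1) -normrM step_binS normrM exprS mulrA.
apply: ler_pM => //.
apply: (le_trans (ler_normB _ _)); rewrite normrM normr_nat -natr1.
have := normr_ge0 x; have := normr_ge0 lam; have : 0 <= n%:R :> R by [].
by move: n%:R `|x| `|lam| => a b c a0 c0 b0; nra.
Qed.

(** The recurrence [step_binS] read as a differential equation for the sum. *)
Lemma step_bin_ode lam x t :
  cvgn (pseries (step_bin lam x) t) -> cvgn (pseries (pseries_diffs (step_bin lam x)) t) ->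
  (1 + lam * t) * limn (pseries (pseries_diffs (step_bin lam x)) t) =
  x * limn (pseries (step_bin lam x) t).
Proof.
move=> cv dcv; rewrite mulrDl mul1r.
(* The same derivative is written with terms in [t ^+ i.-1]; after multiplication by [lam * t] the
   powers line up and the two sides agree on every partial sum. *)
have e := pseries_diffs_equiv dcv.
have : (pseries (pseries_diffs (step_bin lam x)) t +
   (fun N => lam * t * series (fun i => i%:R * step_bin lam x i * t ^+ i.-1) N)) @ \oo -->
   limn (pseries (pseries_diffs (step_bin lam x)) t) +
   lam * t * limn (pseries (pseries_diffs (step_bin lam x)) t).
  by apply: cvgD => //; apply: cvgM e; exact: cvg_cst.
move=> /(cvg_lim (@Rhausdorff R)) <-.
have : (fun N => x * pseries (step_bin lam x) t N) @ \oo --> x * limn (pseries (step_bin lam x) t).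
  by apply: cvgM cv; exact: cvg_cst.
move=> /(cvg_lim (@Rhausdorff R)) <-.
congr (limn _); apply/funext => N; rewrite fctE /pseries /series /=.
rewrite !mulr_sumr -big_split/=; apply: eq_bigr => i _.
rewrite /pseries_diffs step_binS.
case: i => [|i] /=; first by ring.
by rewrite exprS; ring.
Qed.

Lemma near_addr_gt0 lam : \forall t \near (0 : R), 0 < 1 + lam * t.
Proof.
have : (fun t : R => 1 + lam * t) t @[t --> (0 : R)] --> 1 + lam * 0.
  by apply: cvgD; [exact: cvg_cst|apply: cvgM; [exact: cvg_cst|exact: cvg_id]].
by move/cvgr_gt; apply; rewrite mulr0 addr0.
Qed.

(* By [step_bin_ode], the sum [f] of the series satisfies [(1 + lam t) f' = x f],
   so [f t * (1 + lam t)^(- x / lam)] is locally constant. *)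
Lemma binomial_series lam x : lam != 0 ->
  \forall t \near (0 : R),
    pseries (step_bin lam x) t @ \oo --> (1 + lam * t) `^ (x / lam).
Proof.
move=> lam0; have bc := step_bin_geom_bounded lam x.
pose f t := limn (pseries (step_bin lam x) t).
pose h t := expR (- (x / lam) * ln (1 + lam * t)).
have pos := near_addr_gt0 lam.
have : \forall t \near (0 : R), is_derive t (1 : R) (fun t => f t * h t) 0.
  near=> t.
  have t0 : 0 < 1 + lam * t by near: t.
  have df : is_derive t (1 : R) f (limn (pseries (pseries_diffs (step_bin lam x)) t)).
    by near: t; exact: geom_bounded_near_derive.
  have dh : is_derive t (1 : R) h (h t * (- (x / lam) * ((1 + lam * t)^-1 * lam))).
    have dl : is_derive t (1 : R) (fun t => 1 + lam * t) lam.
      by apply: is_derive_eq; rewrite add0r mul1r [_%:A]mulr1.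
    have dln := @is_derive1_comp R (@ln R) _ t _ _ (is_derive1_ln t0) dl.
    exact: is_derive1_comp (is_derive_expR _) (is_deriveZ (- (x / lam)) dln).
  have ode : (1 + lam * t) * limn (pseries (pseries_diffs (step_bin lam x)) t) = x * f t.
    apply: step_bin_ode; near: t; apply: geom_bounded_near_cvg => //.
    exact: geom_bounded_diffs.
  apply: (is_derive_eq (is_deriveM df dh)); rewrite /GRing.scale/=.
  have -> : limn (pseries (pseries_diffs (step_bin lam x)) t) = x * f t / (1 + lam * t).
    by rewrite -ode mulrAC divff ?mul1r// gt_eqF.
  by field; rewrite lam0 gt_eqF.
(* The constant is the value at 0, where both factors equal 1. *)
move=> /near_derive0_cst; rewrite /h mulr0 addr0 ln1 mulr0 expR0 mulr1.
rewrite /f pseries_at0 /step_bin /step_falling big_ord0 fact0 divr1 => fh.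
near=> t.
have t0 : 0 < 1 + lam * t by near: t.
have ft : limn (pseries (step_bin lam x) t) * expR (- (x / lam) * ln (1 + lam * t)) = 1.
  by near: t.
have -> : (1 + lam * t) `^ (x / lam) = limn (pseries (step_bin lam x) t).
  rewrite /powR gt_eqF//; apply: (mulIf (lt0r_neq0 (expR_gt0 (- (x / lam) * ln (1 + lam * t))))).
  by rewrite ft -expRD -mulrDl addrN mul0r expR0.
by near: t; exact: geom_bounded_near_cvg.
Unshelve. all: by end_near.
Qed.

End BinomialSeries.

(** * Iterated forward differences and Stirling numbers *)

Section ForwardDifferences.
Context {R : realType}.
Implicit Types (f : R -> R) (lam x y : R).

(** Induction on [k]; Pascal's rule merges the two sums, one of them shifted by 1. *)
Lemma iter_fwd_diffE f k x : iter k (@fwd_diff R) f x =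
  \sum_(l < k.+1) (-1) ^+ (k - l) * 'C(k, l)%:R * f (x + l%:R).
Proof.
elim: k x => [|k IHk] x.
  by rewrite big_ord1 bin0 !mul1r addr0.
rewrite iterS {1}/fwd_diff !IHk [RHS]big_ord_recl /= subn0 bin0 mulr1 addr0.
under [X in _ = _ + X]eq_bigr => l _ do
  rewrite /bump /= add1n subSS binS natrD mulrDr mulrDl.
rewrite big_split/= [X in _ = _ + (X + _)]big_ord_recr/= bin_small// mulr0 mul0r addr0.
rewrite [X in _ - X = _]big_ord_recl/= subn0 bin0 mulr1 addr0.
have -> : \sum_(i < k) (-1) ^+ (k - bump 0 i) * 'C(k, bump 0 i)%:R * f (x + (bump 0 i)%:R) =
    - \sum_(i < k) (-1) ^+ (k - i) * 'C(k, i.+1)%:R * f (x + i.+1%:R).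
  rewrite -sumrN; apply: eq_bigr => i _.
  by rewrite /bump add1n -[in RHS](subnSK (ltn_ord i)) exprS mulN1r !mulNr opprK.
have -> : \sum_(l < k.+1) (-1) ^+ (k - l) * 'C(k, l)%:R * f (x + 1 + l%:R) =
    \sum_(l < k.+1) (-1) ^+ (k - l) * 'C(k, l)%:R * f (x + l.+1%:R).
  by apply: eq_bigr => l _; rewrite -addrA nat1r.
by rewrite exprS; ring.
Qed.

(** One difference turns [y ^+ j] into a combination of powers below [j], so induction on [k]
    applies. *)
Lemma iter_fwd_diff_pow k j x : (j < k)%N ->
  iter k (@fwd_diff R) (fun y => y ^+ j) x = 0.
Proof.
elim: k j x => // k IHk j x; rewrite ltnS => jk; rewrite iterSr.
have -> : fwd_diff (fun y : R => y ^+ j) =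
    (fun y => \sum_(i < j) 'C(j, i)%:R * y ^+ i).
  apply/funext => y; rewrite /fwd_diff [y + 1]addrC exprDn big_ord_recr/= binn.
  rewrite subnn expr0 mul1r mulr1n addrK; apply: eq_bigr => i _.
  by rewrite expr1n mul1r mulr_natl.
(* Linearity of the iterated difference: expand by the explicit sum, exchange, and fold back. *)
rewrite iter_fwd_diffE.
under eq_bigr => l _ do rewrite mulr_sumr.
rewrite exchange_big/= big1// => i _.
transitivity ('C(j, i)%:R * iter k (@fwd_diff R) (fun y => y ^+ i) x); last first.
  by rewrite IHk ?mulr0//; exact: leq_trans jk.
rewrite iter_fwd_diffE mulr_sumr; apply: eq_bigr => l _.
by rewrite mulrCA.
Qed.

(** Homogenization: [step_falling lam y n] is [lam ^+ n] times the ordinary falling factorial at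
    [y / lam]. *)
Lemma sum_stirling1 lam y n : lam != 0 ->
  \sum_(0 <= j < n.+1) lam ^+ (n - j) * (stirling1 n j)%:~R * y ^+ j =
  step_falling lam y n.
Proof.
move=> lam0; rewrite /stirling1; set P := \prod_(i < n) _.
have sP : size P = n.+1 by rewrite size_prod_XsubC /index_enum -enumT size_enum_ord.
have -> : step_falling lam y n = lam ^+ n * (map_poly intr P).[y / lam].
  rewrite rmorph_prod horner_prod -[in lam ^+ n](card_ord n) -prodr_const -big_split/=.
  apply: eq_bigr => i _.
  by rewrite rmorphB/= map_polyX map_polyC/= !hornerE/= rmorph_nat; field.
rewrite (@horner_coef_wide _ n.+1); last by rewrite (leq_trans (size_poly _ _))// sP.
rewrite big_mkord mulr_sumr; apply: eq_bigr => j _.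
have jn : (j <= n)%N by rewrite -ltnS.
have -> : lam ^+ n = lam ^+ (n - j) * lam ^+ j by rewrite -exprD subnK.
rewrite coef_map/= expr_div_n.
have lj0 : lam ^+ j != 0 by rewrite expf_neq0.
by field.
Qed.

End ForwardDifferences.

(** * Expansion of the Whitney generating function *)

Section Whitney.
Local Open Scope classical_set_scope.
Local Open Scope ring_scope.
Context {R : realType}.
Implicit Types (lam t : R) (w : nat -> R).

(** The left-hand side of the theorem as a sequence in [n], to be tested against
    [whitney_expansion]. *)
Definition whitney_coef lam (m r k n : nat) : R :=
  (k`!%:R * m%:R ^+ k)^-1 *
    (\sum_(0 <= j < n.+1)
       lam ^+ (n - j) * (stirling1 n j)%:~R * m%:R ^+ j
       * iter k (@fwd_diff R) (fun x : R => x ^+ j) (r%:R / m%:R)).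

Lemma whitney_coef_small lam m r k n : (n < k)%N -> whitney_coef lam m r k n = 0.
Proof.
move=> nk; rewrite /whitney_coef big_nat big1 ?mulr0// => j /andP[_ jn].
by rewrite iter_fwd_diff_pow ?mulr0// (leq_trans jn).
Qed.

(** The factor [m%:R ^+ j] turns the node [r / m + l] into [r + m * l], and the sum over [j] becomes
    a falling factorial. *)
Lemma whitney_coefE lam m r k n : lam != 0 -> (0 < m)%N ->
  whitney_coef lam m r k n = (k`!%:R * m%:R ^+ k)^-1 *
    \sum_(l < k.+1) (-1) ^+ (k - l) * 'C(k, l)%:R * step_falling lam (r + m * l)%:R n.
Proof.
move=> lam0 m0; congr (_ * _).
under eq_bigr => j _ do rewrite iter_fwd_diffE mulr_sumr.
rewrite exchange_big/=; apply: eq_bigr => l _.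
rewrite -sum_stirling1// mulr_sumr; apply: eq_bigr => j _.
have mE : (r + m * l)%:R = m%:R * (r%:R / m%:R + l%:R) :> R.
  by rewrite natrD natrM; field; rewrite pnatr_eq0 -lt0n.
by rewrite mE exprMn; ring.
Qed.

Lemma whitney_egfE lam m r k t : lam != 0 -> 0 < 1 + lam * t ->
  whitney_egf lam m r k t = (k`!%:R * m%:R ^+ k)^-1 *
    \sum_(l < k.+1) (-1) ^+ (k - l) * 'C(k, l)%:R * (1 + lam * t) `^ ((r + m * l)%:R / lam).
Proof.
move=> lam0 t0; rewrite /whitney_egf -mulrA [m%:R ^+ k * _]mulrC; congr (_ * _).
rewrite [_ `^ (m%:R / lam) - 1]addrC exprDn mulr_sumr; apply: eq_bigr => l _.
have -> : ((1 + lam * t) `^ (m%:R / lam)) ^+ l = (1 + lam * t) `^ ((m * l)%:R / lam).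
  by rewrite -powR_mulrn ?powR_ge0// -powRrM natrM mulrAC.
rewrite natrD mulrDl powRD ?(gt_eqF t0) ?implybT// -mulr_natl.
by ring.
Qed.

(** Padding with zeros below [k] makes the lemmas on [pseries] applicable. *)
Lemma whitney_sumE k w t N :
  \sum_(k <= n < N) w n * (t ^+ n / n`!%:R) =
  pseries (fun n => if (k <= n)%N then w n / n`!%:R else 0) t N.
Proof.
rewrite (big_nat_widenl _ 0)//= big_mkcond /pseries /series /=.
by apply: eq_bigr => n _; case: ifP => _; rewrite ?mul0r// mulrAC mulrA.
Qed.

(** The difference of the two zero-padded series converges to 0 near 0, so [pseries_eq0] applies. *)
Lemma whitney_expansion_unique lam m r k w w' n :
  whitney_expansion lam m r k w -> whitney_expansion lam m r k w' ->
  (k <= n)%N -> w n = w' n.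
Proof.
move=> ww ww' kn.
pose c w n : R := if (k <= n)%N then w n / n`!%:R else 0.
have cw v : whitney_expansion lam m r k v ->
    \forall t \near (0 : R), pseries (c v) t @ \oo --> whitney_egf lam m r k t.
  by apply: filterS => t; under eq_fun do rewrite whitney_sumE.
have c0 : \forall t \near (0 : R), pseries (fun n => c w n - c w' n) t @ \oo --> (0 : R).
  near=> t.
  have -> : pseries (fun n => c w n - c w' n) t = pseries (c w) t - pseries (c w') t.
    apply/funext => N; rewrite fctE /pseries /series /= -sumrB.
    by apply: eq_bigr => i _; rewrite mulrBl.
  rewrite -(subrr (whitney_egf lam m r k t)).
  by apply: cvgB; near: t; exact: cw.
have /eqP : c w n - c w' n = 0.
  apply: (pseries_eq0 (fun n => c w n - c w' n)).
    by apply: filterS c0 => t; exact: cvgP.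
  by apply: filterS c0 => t; exact: cvg_lim.
rewrite subr_eq0 /c kn => /eqP /(congr1 (fun x => x * n`!%:R)).
by rewrite !divfK // pnatr_eq0 -lt0n fact_gt0.
Unshelve. all: by end_near.
Qed.

Lemma whitney_expansion_coef lam m r k : lam != 0 -> (0 < m)%N ->
  whitney_expansion lam m r k (whitney_coef lam m r k).
Proof.
move=> lam0 m0; rewrite /whitney_expansion.
have pos := near_addr_gt0 lam.
have bin : \forall t \near (0 : R), forall l : 'I_k.+1,
    pseries (step_bin lam (r + m * l)%:R) t @ \oo -->
    (1 + lam * t) `^ ((r + m * l)%:R / lam).
  (* Only finitely many [l] occur, so one neighbourhood of 0 serves all of them. *)
  by apply: (@filter_forall R _ _ _ (nbhs_filter (0 : R))) => l; exact: binomial_series.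
near=> t.
have bt : forall l : 'I_k.+1, pseries (step_bin lam (r + m * l)%:R) t @ \oo -->
    (1 + lam * t) `^ ((r + m * l)%:R / lam) by near: t.
rewrite whitney_egfE//; last by near: t.
(* Equality holds for each partial sum: the terms below [k] missing on the left vanish by
   [whitney_coef_small]. *)
have -> : (fun N => \sum_(k <= n < N) whitney_coef lam m r k n * (t ^+ n / n`!%:R)) =
  (fun N => (k`!%:R * m%:R ^+ k)^-1 *
    \sum_(l < k.+1) (-1) ^+ (k - l) * 'C(k, l)%:R *
      pseries (step_bin lam (r + m * l)%:R) t N).
  apply/funext => N; rewrite (big_nat_widenl _ 0)//= big_mkcond/=.
  under [in RHS]eq_bigr => l _ do rewrite /pseries /series /= mulr_sumr.
  rewrite exchange_big/= mulr_sumr; apply: eq_bigr => n _.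
  transitivity (whitney_coef lam m r k n * (t ^+ n / n`!%:R)).
    by case: leqP => // nk; rewrite whitney_coef_small// mul0r.
  rewrite whitney_coefE// -mulrA; congr (_ * _).
  rewrite mulr_suml; apply: eq_bigr => l _.
  by rewrite /step_bin; ring.
apply: cvgM; first exact: cvg_cst.
apply: cvg_big => [|l _]; first exact: add_continuous.
by apply: cvgM; [exact: cvg_cst|exact: bt].
Unshelve. all: by end_near.
Qed.

End Whitney.

Theorem theorem7 (R : realType) (lam : R) (m n k r : nat)
    (hlam : lam != 0) (hm : (0 < m)%N) :
  (k`!%:R * m%:R ^+ k)^-1 *
    (\sum_(0 <= j < n.+1)
       lam ^+ (n - j) * (stirling1 n j)%:~R * m%:R ^+ j
       * iter k (@fwd_diff R) (fun x : R => x ^+ j) (r%:R / m%:R))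
  = if (k <= n)%N then degenerate_whitney lam m r n k else 0.
Proof.
have W := whitney_expansion_coef lam m r k hlam hm.
case: leqP => [kn|nk]; last exact: whitney_coef_small.
apply: (whitney_expansion_unique lam m r k _ _ n W _ kn).
(* [W] shows that an expansion exists, so the sequence picked by [get] is itself an expansion. *)
exact: (@getI _ [set w | whitney_expansion lam m r k w]%classic _ W).
Qed.
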